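(* Let $f:[\underline{x},\overline{x}]\to\mathbb{R}$ be concave, let $N\ge 3$, and let $(x_1,x_2,\dots,x_N)$ be a breakpoint set on $[\underline{x},\overline{x}]$ that is optimal for minimizing the maximum absolute error. Then the maximum absolute errors of all the intervals are equal, i.e. $E(x_1,x_2)=E(x_2,x_3)=\cdots=E(x_{N-1},x_N)$.
   Context: For $u<v$ in $[\underline{x},\overline{x}]$, let $L_{u,v}(x)=f(u)+\frac{f(v)-f(u)}{v-u}(x-u)$ be the linear function through $(u,f(u))$ and $(v,f(v))$, and let $E(u,v)=\max_{x\in[u,v]}|f(x)-L_{u,v}(x)|$ be the maximum absolute error of the interval $[u,v]$. A breakpoint set with $N$ breakpoints on $[\underline{x},\overline{x}]$ is a tuple $(x_1,\dots,x_N)$ with $x_1=\underline{x}$, $x_N=\overline{x}$ (fixed endpoints) and $x_i<x_{i+1}$ for all $i$. Its maximum absolute error is $E_{\max}=\max_{1\le i\le N-1}E(x_i,x_{i+1})$. A breakpoint set is optimal for minimizing the maximum absolute error if its $E_{\max}$ is minimal among all breakpoint sets with $N$ breakpoints on $[\underline{x},\overline{x}]$.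
   Formalization: It is assumed that the maximum defining E(u,v) exists for all u<v in the interval (true if f is continuous); a concave f may jump at an endpoint: with f(0)=0 and f=1 on (0,1], E(0,v) is undefined, and read as a supremum the claim fails for N=3. *)

(* Defs.v *)
From HB Require Import structures.
From mathcomp Require Import all_boot all_order all_algebra.
From mathcomp Require Import all_classical all_reals all_analysis.
Import Order.TTheory GRing.Theory Num.Theory.
Import numFieldNormedType.Exports.

Set Implicit Arguments.
Unset Strict Implicit.
Unset Printing Implicit Defensive.

Local Open Scope classical_set_scope.
Local Open Scope ring_scope.

Section PiecewiseLinearInterpolation.
Context {R : realType}.
Implicit Types (f : R -> R) (a b u v : R).

(* Functions on [a, b] are total functions R -> R; nothing below depends on
   their values outside [a, b]. *)

Definition concave_on a b f : Prop :=
  convex_function (`[a, b]%classic : set R^o) (fun x : R^o => - f x : R^o).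

Definition chord f u v : R -> R :=
  fun x => f u + (f v - f u) / (v - u) * (x - u).

Definition abs_error f u v : R -> R := fun x => `|f x - chord f u v x|.

(* The supremum is the maximum as soon as the latter exists, which is what
   [max_errors_exist] asserts for all subintervals of [a, b]. *)
Definition max_error f u v : R := sup (abs_error f u v @` `[u, v]).

(* A concave function may jump at a and at b, in which case the maximum of the
   absolute error can fail to exist. Continuity of f on [a, b] is sufficient
   (see [continuous_max_errors_exist]). *)
Definition max_errors_exist f a b : Prop :=
  forall u v, a <= u -> u < v -> v <= b ->
    exists2 x0, x0 \in `[u, v] &
      forall x, x \in `[u, v] -> abs_error f u v x <= abs_error f u v x0.

(* The breakpoints x_1, ..., x_N are x`_0, ..., x`_N.-1. *)
Definition breakpoint_set a b (N : nat) (x : N.-tuple R) : Prop :=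
  [/\ x`_0 = a, x`_N.-1 = b &
      forall i : nat, (i.+1 < N)%N -> x`_i < x`_i.+1].

(* The neutral element 0 is harmless since all the errors are nonnegative. *)
Definition total_max_error f (N : nat) (x : N.-tuple R) : R :=
  \big[Num.max/0]_(i < N.-1) max_error f x`_i x`_i.+1.

Definition optimal_breakpoint_set f a b (N : nat) (x : N.-tuple R) : Prop :=
  breakpoint_set a b x /\
  forall y : N.-tuple R, breakpoint_set a b y ->
    total_max_error f x <= total_max_error f y.

Lemma max_errorP f a b u v : max_errors_exist f a b ->
  a <= u -> u < v -> v <= b ->
  (abs_error f u v @` `[u, v]) (max_error f u v) /\
  ubound (abs_error f u v @` `[u, v]) (max_error f u v).
Proof.
move=> fE au uv vb; have [x0 x0uv x0max] := fE u v au uv vb.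
have ub : ubound (abs_error f u v @` `[u, v]) (abs_error f u v x0).
  by move=> _ [x /= xuv <-]; exact: x0max.
suff -> : max_error f u v = abs_error f u v x0 by split => //; exists x0.
apply/eqP; rewrite eq_le; apply/andP; split.
  by apply: ge_sup => //; exists (abs_error f u v x0), x0.
by apply: ub_le_sup; [exists (abs_error f u v x0)|exists x0].
Qed.

Lemma continuous_max_errors_exist f a b :
  {within `[a, b], continuous f} -> max_errors_exist f a b.
Proof.
move=> cf u v au uv vb; apply: EVT_max; first exact: ltW.
have {}cf : {within `[u, v], continuous f}.
  apply: continuous_subspaceW cf => x /=; rewrite !in_itv/= => /andP[ux xv].
  by rewrite (le_trans au ux) (le_trans xv vb).
have cL : {within `[u, v], continuous (chord f u v)}.
  apply: continuous_subspaceT => x; apply: cvgD; first exact: cvg_cst.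
  by apply: cvgM; [exact: cvg_cst|apply: cvgB; [exact: cvg_id|exact: cvg_cst]].
by move=> x; apply: cvg_norm; apply: cvgB; [exact: cf|exact: cL].
Qed.

End PiecewiseLinearInterpolation.

(* Main.v *)
Require Import Defs.
From mathcomp Require Import all_boot all_order all_algebra.
From mathcomp Require Import all_classical all_reals all_analysis.
From mathcomp Require Import ring lra zify.
Import Order.TTheory GRing.Theory Num.Theory.
Local Open Scope ring_scope.

Set Implicit Arguments.
Unset Strict Implicit.

(* If E(u, v) > 0, then f lies strictly above the chord on ]u, v[, so that
   E(u, t) < E(u, v) for u < t < v, E(u, t) being attained; conversely,
   E(u, t) exceeds E(u, v) by at most a multiple of t - v when t > v. Hence, if two consecutive intervals have
   different errors, their common breakpoint can be moved so that both errors
   drop below the larger one. In an optimal breakpoint set where some but not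
   all errors are equal to the maximum M, doing so for two consecutive intervals
   exactly one of which has error M yields an optimal breakpoint set with fewer
   intervals of error M; this cannot go on forever. *)

(** * Concavity and chords *)

Lemma concave_onP (R : realType) (a b : R) (f : R -> R) :
  concave_on a b f <-> forall t x y : R, 0 <= t <= 1 ->
    a <= x <= b -> a <= y <= b ->
    t * f x + (1 - t) * f y <= f (t * x + (1 - t) * y).
Proof.
split=> [fC t x y /andP[t0 t1] xab yab|fC t x y].
  have := fC (Itv01 t0 t1) x y; rewrite !inE/= !in_itv/= => /(_ xab yab).
  (* Abstract convex combinations in [R^o] are ordinary arithmetic by conversion, which makes the
     goal accessible to [lra]. *)
  have -> (c d : R^o) :
    conv (Itv01 t0 t1) c d = t * (c : R) + (1 - t) * (d : R) by [].
  have -> : conv (Itv01 t0 t1) (x : convex_lmodType R^o) y =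
    t * x + (1 - t) * y by [].
  lra.
rewrite !inE/= !in_itv/= => xab yab.
have t01 : 0 <= t%:num <= 1 by apply/andP; split.
have := fC _ _ _ t01 xab yab.
have -> (c d : R^o) : conv t c d = t%:num * (c : R) + (1 - t%:num) * (d : R).
  by [].
have -> : conv t x y = t%:num * (x : R) + (1 - t%:num) * (y : R) by [].
lra.
Qed.

Lemma concave_on_chord_le (R : realType) (a b : R) (f : R -> R) (u x v : R) :
  concave_on a b f -> a <= u -> u <= x -> x <= v -> v <= b ->
  chord f u v x <= f x.
Proof.
(* If [u = v], the slope in [chord] is a quotient by zero, but its factor [x - u] vanishes. *)
move=> fC au ux xv vb; have [uv|vu] := ltP u v; last first.
  have -> : x = u by apply/le_anti; rewrite ux (le_trans xv vu).
  by rewrite /chord subrr mulr0 addr0.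
have d0 : v - u != 0 by rewrite subr_eq0 gt_eqF.
have t01 : 0 <= (v - x) / (v - u) <= 1.
  by rewrite ler_pdivrMr ?subr_gt0// mul1r divr_ge0; lra.
have uab : a <= u <= b by rewrite au (le_trans (ltW uv) vb).
have vab : a <= v <= b by rewrite vb (le_trans au (ltW uv)).
have := (concave_onP _ _ _).1 fC _ _ _ t01 uab vab.
have -> : (v - x) / (v - u) * u + (1 - (v - x) / (v - u)) * v = x by field.
apply: le_trans; rewrite le_eqVlt; apply/orP; left.
by apply/eqP; rewrite /chord; field.
Qed.

(** * Reflection at the origin, which exchanges the two ends of an interval *)

Lemma concave_on_opp (R : realType) (a b : R) (f : R -> R) :
  concave_on a b f -> concave_on (- b) (- a) (f \o -%R).
Proof.
move=> /concave_onP fC; apply/concave_onP => t x y t01 xab yab /=.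
by rewrite opprD -!mulrN fC// lerNr lerNl andbC.
Qed.

Lemma chord_opp (R : realType) (f : R -> R) (u v x : R) : u < v ->
  chord (f \o -%R) (- v) (- u) (- x) = chord f u v x.
Proof.
by move=> uv; rewrite /chord /= !opprK; field; rewrite subr_eq0 gt_eqF.
Qed.

Lemma abs_error_opp (R : realType) (f : R -> R) (u v x : R) : u < v ->
  abs_error (f \o -%R) (- v) (- u) (- x) = abs_error f u v x.
Proof. by move=> uv; rewrite /abs_error chord_opp //= opprK. Qed.

Lemma max_error_opp (R : realType) (f : R -> R) (u v : R) : u < v ->
  max_error (f \o -%R) (- v) (- u) = max_error f u v.
Proof.
move=> uv; rewrite /max_error; congr sup.
apply/seteqP; split => _ [x /= xuv <-]; exists (- x).
- by move: xuv; rewrite /= !in_itv/= lerNr lerNl andbC.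
- by rewrite -abs_error_opp// opprK.
- by move: xuv; rewrite /= !in_itv/= !lerN2 andbC.
- exact: abs_error_opp.
Qed.

Lemma max_errors_exist_opp (R : realType) (a b : R) (f : R -> R) :
  max_errors_exist f a b -> max_errors_exist (f \o -%R) (- b) (- a).
Proof.
move=> fE u v bu uv va; have vu : - v < - u by rewrite ltrN2.
have [||| x0 x0uv x0M] := fE (- v) (- u).
- by rewrite lerNr.
- by rewrite ltrN2.
- by rewrite lerNl.
exists (- x0); first by move: x0uv; rewrite !in_itv/= lerNr lerNl andbC.
move=> x xuv; rewrite -[u]opprK -[v]opprK -[x]opprK !abs_error_opp//.
by apply: x0M; move: xuv; rewrite !in_itv/= !lerN2 andbC.
Qed.

(** * Errors of a concave function, without absolute values *)

Lemma abs_error_concave (R : realType) (a b : R) (f : R -> R) (u v x : R) :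
  concave_on a b f -> a <= u -> v <= b -> u <= x -> x <= v ->
  abs_error f u v x = f x - chord f u v x.
Proof.
move=> fC au vb ux xv; apply: ger0_norm.
by rewrite subr_ge0; apply: concave_on_chord_le fC _ _ _ _.
Qed.

Lemma max_error_attained (R : realType) (a b : R) (f : R -> R) (u v : R) :
  concave_on a b f -> max_errors_exist f a b -> a <= u -> u < v -> v <= b ->
  exists x0, [/\ u <= x0, x0 <= v & max_error f u v = f x0 - chord f u v x0].
Proof.
move=> fC fE au uv vb; have [[x0 /=]] := max_errorP fE au uv vb.
rewrite in_itv/= => /andP[ux0 x0v] <- _; exists x0; split=> //.
exact: abs_error_concave fC _ _ _ _.
Qed.

Lemma le_max_error (R : realType) (a b : R) (f : R -> R) (u v x : R) :
  concave_on a b f -> max_errors_exist f a b -> a <= u -> u < v -> v <= b ->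
  u <= x -> x <= v -> f x - chord f u v x <= max_error f u v.
Proof.
move=> fC fE au uv vb ux xv; rewrite -(abs_error_concave fC)//.
by apply: (max_errorP fE au uv vb).2; exists x => //=; rewrite in_itv/= ux.
Qed.

Lemma max_error_ge0 (R : realType) (a b : R) (f : R -> R) (u v : R) :
  concave_on a b f -> max_errors_exist f a b -> a <= u -> u < v -> v <= b ->
  0 <= max_error f u v.
Proof.
move=> fC fE au uv vb.
have := le_max_error fC fE au uv vb (lexx u) (ltW uv).
by rewrite /chord !subrr mulr0 addr0 subrr.
Qed.

(** * Slopes of chords, and the error when one endpoint moves *)

Definition slope (R : realType) (f : R -> R) (u v : R) : R :=
  (f v - f u) / (v - u).

Lemma slopeM (R : realType) (f : R -> R) (u v : R) : u < v ->
  slope f u v * (v - u) = f v - f u.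
Proof. by move=> uv; rewrite divfK// subr_eq0 gt_eqF. Qed.


Lemma slope_lel (R : realType) (a b : R) (f : R -> R) (u x v : R) :
  concave_on a b f -> a <= u -> u < x -> x < v -> v <= b ->
  slope f u v <= slope f u x.
Proof.
move=> fC au ux xv vb.
have := concave_on_chord_le fC au (ltW ux) (ltW xv) vb.
by rewrite ler_pdivlMr ?subr_gt0// /chord -/(slope f u v); lra.
Qed.

Lemma slope_ler (R : realType) (a b : R) (f : R -> R) (u x v : R) :
  concave_on a b f -> a <= u -> u < x -> x < v -> v <= b ->
  slope f x v <= slope f u v.
Proof.
move=> fC au ux xv vb.
have := concave_on_chord_le fC au (ltW ux) (ltW xv) vb.
have := slopeM f (lt_trans ux xv).
by rewrite ler_pdivrMr ?subr_gt0// /chord -/(slope f u v); lra.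
Qed.

(** The graph meets the chord over the interior point [t]. If it were strictly above the chord at
    some [y], the chord from [y] to the end of [[u, v]] beyond [t] would pass strictly above the
    graph at [t], against concavity. *)
Lemma max_error_eq0 (R : realType) (a b : R) (f : R -> R) (u t v : R) :
  concave_on a b f -> max_errors_exist f a b -> a <= u -> v <= b ->
  u < t -> t < v -> slope f u t = slope f u v -> max_error f u v = 0.
Proof.
move=> fC fE au vb ut tv sE; have uv := lt_trans ut tv.
apply/le_anti; rewrite (max_error_ge0 fC fE)// andbT.
have [y [uy yv ->]] := max_error_attained fC fE au uv vb.
rewrite /chord -/(slope f u v) subr_le0.
have := slopeM f uv; have := slopeM f ut; rewrite sE => Mt Mv.
have [{}uy|] := ltP u y; last first.
  move=> yu; have -> : y = u by apply/le_anti; rewrite yu uy.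
  lra.
have [yt|ty] := ltP y t; last first.
  have [{}ty|yt] := ltP t y; last first.
    have -> : y = t by apply/le_anti; rewrite yt ty.
    lra.
  have := slope_lel fC au ut ty (le_trans yv vb).
  by rewrite sE ler_pdivrMr ?subr_gt0//; lra.
have yab := le_trans au (ltW uy).
have := slope_ler fC yab yt tv vb; have := slope_lel fC yab yt tv vb.
rewrite (_ : slope f t v = slope f u v); last first.
  apply: (@mulIf _ (v - t)); first by rewrite subr_eq0 gt_eqF.
  by rewrite slopeM//; lra.
move=> h1 h2; have := le_trans h2 h1.
by rewrite ler_pdivlMr ?subr_gt0//; lra.
Qed.

(** Both chords start over [u], and the one of [[u, t]] is strictly steeper: equal slopes would give
    error 0 by [max_error_eq0]. Hence the error at the point where E(u, t) is attained is strictly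
    smaller than the error there for [[u, v]]. *)
Lemma max_error_shrink (R : realType) (a b : R) (f : R -> R) (u t v : R) :
  concave_on a b f -> max_errors_exist f a b -> a <= u -> v <= b ->
  u < t -> t < v -> 0 < max_error f u v -> max_error f u t < max_error f u v.
Proof.
move=> fC fE au vb ut tv E0; have uv := lt_trans ut tv.
have [x [ux xt ->]] :=
  max_error_attained fC fE au ut (ltW (lt_le_trans tv vb)).
have [->|xu] := eqVneq x u; first by rewrite /chord !subrr mulr0 addr0 subrr.
have {xu}ux : u < x by rewrite lt_neqAle eq_sym xu.
have xv := le_lt_trans xt tv.
apply: lt_le_trans (le_max_error fC fE au uv vb (ltW ux) (ltW xv)).
rewrite ltrD2l ltrN2 /chord ltrD2l -!/(slope _ _ _) ltr_pM2r ?subr_gt0//.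
rewrite lt_neqAle (slope_lel fC au ut tv vb) andbT.
apply: contraTneq E0 => /esym sE.
by rewrite (max_error_eq0 fC fE au vb ut tv sE) ltxx.
Qed.

(* To the right of [v], the graph of [f] lies below the line through the points
   over [u] and [v], and above the chord of [[v, w]]; the second summand is the
   difference of these two lines at [t]. *)
Lemma max_error_extend (R : realType) (a b : R) (f : R -> R) (u v t w : R) :
  concave_on a b f -> max_errors_exist f a b -> a <= u -> w <= b ->
  u < v -> v < t -> t < w ->
  max_error f u t <= max_error f u v + (slope f u v - slope f v w) * (t - v).
Proof.
move=> fC fE au wb uv vt tw.
have tb := le_trans (ltW tw) wb; have ut := lt_trans uv vt.
have vb := le_trans (ltW vt) tb; have av := le_trans au (ltW uv).
have [x [ux xt ->]] := max_error_attained fC fE au ut tb.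
have E0 := max_error_ge0 fC fE au uv vb.
(* The line through the points over [u] and [v] is prolonged beyond [v], where [f] lies below it. *)
have xE : f x - f u - slope f u v * (x - u) <= max_error f u v.
  have [xv|vx] := leP x v.
    by rewrite -addrA -opprD; exact: le_max_error fC fE _ _ _ _ _.
  have := slope_lel fC au uv vx (le_trans xt tb).
  rewrite ler_pdivrMr ?subr_gt0 ?(lt_trans uv vx)//; lra.
have rs := slope_lel fC au uv vt tb.
have Mv := slopeM f uv; have Mt := slopeM f ut.
have := slope_lel fC av vt tw wb; rewrite ler_pdivlMr ?subr_gt0// => ft.
(* The gap between the prolonged line and the chord of [[u, t]] grows with the distance from [u], so
   it is largest at [t]. *)
have : (slope f u v - slope f u t) * (x - u) <=
       (slope f u v - slope f u t) * (t - u).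
  by rewrite ler_wpM2l ?subr_ge0// lerD2r.
rewrite /chord -/(slope f u t); lra.
Qed.

(** * Balancing two consecutive intervals *)

Lemma balance_lt (R : realType) (a b : R) (f : R -> R) (u v w : R) :
  concave_on a b f -> max_errors_exist f a b -> a <= u -> w <= b ->
  u < v -> v < w -> max_error f u v < max_error f v w ->
  exists t, [/\ u < t, t < w, max_error f u t < max_error f v w &
    max_error f t w < max_error f v w].
Proof.
move=> fC fE au wb uv vw E12.
have av := le_trans au (ltW uv); have vb := le_trans (ltW vw) wb.
have E2 := le_lt_trans (max_error_ge0 fC fE au uv vb) E12.
pose k := slope f u v - slope f v w.
have k0 : 0 <= k.
  rewrite subr_ge0 (le_trans _ (slope_lel fC au uv vw wb))//.
  exact: slope_ler fC _ _ _ _.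
pose g := max_error f v w - max_error f u v.
(* The first bound keeps [v + d] below [w]. The second makes the growth [k * d] of the left error
   strictly smaller than the gap [g]; the [+ 1] gives strictness and covers [k = 0]. *)
pose d := Num.min ((w - v) / 2) (g / (k + 1)).
have g0 : 0 < g by rewrite subr_gt0.
have d0 : 0 < d by rewrite lt_min !divr_gt0 ?subr_gt0//; lra.
have dw : d <= (w - v) / 2 by rewrite ge_min lexx.
have dg : d * (k + 1) <= g.
  by rewrite -ler_pdivlMr ?ge_min ?lexx ?orbT//; lra.
have vt : v < v + d by lra.
have tw : v + d < w by lra.
exists (v + d); split=> //; first exact: lt_trans uv vt.
  apply: le_lt_trans (max_error_extend fC fE au wb uv vt tw) _.
  by rewrite -/k; move: dg d0; rewrite /g; lra.
(* Moving the left end of [[v, w]] inwards is, after reflection, the situation of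
   [max_error_shrink]. *)
rewrite -(max_error_opp f tw) -(max_error_opp f vw).
have fC' := concave_on_opp fC; have fE' := max_errors_exist_opp fE.
by apply: max_error_shrink fC' fE' _ _ _ _ _;
  rewrite ?lerN2 ?ltrN2// max_error_opp.
Qed.

Lemma balance (R : realType) (a b : R) (f : R -> R) (u v w : R) :
  concave_on a b f -> max_errors_exist f a b -> a <= u -> w <= b ->
  u < v -> v < w -> max_error f u v != max_error f v w ->
  exists t, [/\ u < t, t < w,
    max_error f u t < Num.max (max_error f u v) (max_error f v w) &
    max_error f t w < Num.max (max_error f u v) (max_error f v w)].
Proof.
move=> fC fE au wb uv vw; rewrite neq_lt => /orP[E12|E21].
  have [t [ut tw h1 h2]] := balance_lt fC fE au wb uv vw E12.
  by exists t; split=> //; rewrite lt_max ?h1 ?h2 orbT.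
(* The larger error is now on the left; reflection puts it on the right. *)
have [|||||t] := @balance_lt R (- b) (- a) (f \o -%R) (- w) (- v) (- u)
  (concave_on_opp fC) (max_errors_exist_opp fE).
- by rewrite lerN2.
- by rewrite lerN2.
- by rewrite ltrN2.
- by rewrite ltrN2.
- by rewrite !max_error_opp.
rewrite -[t]opprK !ltrN2 => -[tw ut].
rewrite !max_error_opp// => h1 h2.
by exists (- t); split=> //; rewrite lt_max ?h1 ?h2.
Qed.

(** * Breakpoint sets and the displacement of one breakpoint *)

Lemma le_total_max_error (R : realType) (f : R -> R) (N : nat) (x : N.-tuple R)
    (i : nat) :
  (i.+1 < N)%N -> max_error f x`_i x`_i.+1 <= total_max_error f x.
Proof.
move=> iN; have iN1 : (i < N.-1)%N by lia.
exact: (le_bigmax 0 (fun i : 'I__ => max_error f x`_i x`_i.+1) (Ordinal iN1)).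
Qed.

Lemma breakpoint_set_itv (R : realType) (a b : R) (N : nat) (x : N.-tuple R)
    (i : nat) :
  breakpoint_set a b x -> (i < N)%N -> a <= x`_i <= b.
Proof.
move=> [x0 xN xS] iN.
have mono j k : (j <= k)%N -> (k < N)%N -> x`_j <= x`_k.
  elim: k => [|k IH]; first by rewrite leqn0 => /eqP ->.
  rewrite leq_eqVlt => /orP[/eqP -> //|jk kN].
  by rewrite (le_trans (IH jk (ltnW kN)))// ltW// xS.
by rewrite -{1}x0 -xN !mono//; lia.
Qed.

Definition move_breakpoint (R : realType) (N : nat) (x : N.-tuple R) (q : nat)
  (t : R) : N.-tuple R := [tuple if i == q :> nat then t else x`_i | i < N].

Lemma nth_move_breakpoint (R : realType) (N : nat) (x : N.-tuple R) (q : nat)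
    (t : R) (i : nat) :
  (i < N)%N -> (move_breakpoint x q t)`_i = if i == q then t else x`_i.
Proof. by move=> iN; rewrite -[i]/(nat_of_ord (Ordinal iN)) nth_mktuple. Qed.

Lemma breakpoint_set_move (R : realType) (a b : R) (N : nat) (x : N.-tuple R)
    (p : nat) (t : R) :
  breakpoint_set a b x -> (p.+2 < N)%N -> x`_p < t -> t < x`_p.+2 ->
  breakpoint_set a b (move_breakpoint x p.+1 t).
Proof.
move=> [x0 xN xS] pN pt tp; split=> [||i iN].
- by rewrite nth_move_breakpoint//; lia.
- by rewrite nth_move_breakpoint ?xN; [case: eqP => // |]; lia.
- rewrite !nth_move_breakpoint ?(ltnW iN)// eqSS.
  have [->|ip] := eqVneq i p; first by rewrite ltn_eqF.
  by have [->|_] := eqVneq i p.+1; last exact: xS.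
Qed.

(** * Descent on the number of intervals of maximal error *)

Lemma adjacent_change (P : pred nat) (n i j : nat) :
  (i < n)%N -> (j < n)%N -> P i -> ~~ P j ->
  exists2 p, (p.+1 < n)%N & P p != P p.+1.
Proof.
move=> i_n j_n Pi Pj; apply: contrapT => PS.
have PE k : (k < n)%N -> P k = P 0%N.
  elim: k => // k IH kn; rewrite -IH ?(ltnW kn)//.
  by apply/esym/eqP; apply: contraT => Pk; case: PS; exists k.
by move: Pi Pj; rewrite (PE i)// (PE j)// => ->.
Qed.

(** The induction is on the strict bound [k]. The induction hypothesis, applied to the modified set
    [y], would make all errors of [y] equal to the maximum, whereas the two intervals next to the
    moved breakpoint have smaller errors. *)
Lemma optimal_errors_eq (R : realType) (a b : R) (f : R -> R) (N k : nat)
    (x : N.-tuple R) :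
  concave_on a b f -> max_errors_exist f a b ->
  optimal_breakpoint_set f a b x ->
  (#|[set i : 'I_N.-1 | max_error f x`_i x`_i.+1 == total_max_error f x]%SET|
    < k)%N ->
  forall i, (i.+1 < N)%N -> max_error f x`_i x`_i.+1 = total_max_error f x.
Proof.
move=> fC fE; elim: k x => // k IH x [xB xO] xk i iN.
set M := total_max_error f x in xk *.
pose E (z : N.-tuple R) j := max_error f z`_j z`_j.+1.
have ordN (l : 'I_N.-1) : (l.+1 < N)%N by have := ltn_ord l; lia.
have xM j : (j.+1 < N)%N -> E x j <= M by exact: le_total_max_error.
apply/eqP; apply: contraT => Ei.
have EiM : E x i < M by rewrite lt_neqAle Ei xM.
have xab j : (j < N)%N -> a <= x`_j <= b by exact: breakpoint_set_itv.
have xS j : (j.+1 < N)%N -> x`_j < x`_j.+1 by case: xB => _ _; exact.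
have M0 : 0 < M.
  apply: le_lt_trans EiM; apply: max_error_ge0 fC fE _ (xS _ iN) _.
    by have /andP[] := xab i (ltnW iN).
  by have /andP[] := xab i.+1 iN.
(* Since [0 < M], the default value 0 of the big maximum cannot account for [M], so some interval
   attains it. *)
have [j jN EjM] : exists2 j, (j < N.-1)%N & E x j == M.
  apply: contrapT => Ej; suff : M < M by rewrite ltxx.
  apply: bigmax_lt => // l _; rewrite lt_neqAle xM// andbT.
  by apply/negP => El; apply: Ej; exists l.
have [p pN Ep] : exists2 p, (p.+1 < N.-1)%N & (E x p == M) != (E x p.+1 == M).
  by apply: (@adjacent_change (fun j => E x j == M) _ j i) => //; lia.
have pN2 : (p.+2 < N)%N by lia.
have pN1 := ltnW pN2.
have /andP[ap _] := xab p (ltnW pN1); have /andP[_ pb] := xab p.+2 pN2.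
have EpN : E x p != E x p.+1 by apply: contraNneq Ep => ->.
have [t [pt tp Ept Etp]] := balance fC fE ap pb (xS _ pN1) (xS _ pN2) EpN.
have maxM : Num.max (E x p) (E x p.+1) <= M by rewrite ge_max !xM.
pose y := move_breakpoint x p.+1 t.
have yB : breakpoint_set a b y by exact: breakpoint_set_move.
have yE l : (l < N)%N -> y`_l = if l == p.+1 then t else x`_l.
  exact: nth_move_breakpoint.
have Eyp : E y p < M.
  rewrite /E (yE p (ltnW pN1)) (yE _ pN1) eqxx ltn_eqF//.
  exact: lt_le_trans Ept maxM.
have EyS : E y p.+1 < M.
  rewrite /E (yE _ pN1) (yE _ pN2) eqxx gtn_eqF//.
  exact: lt_le_trans Etp maxM.
have EyE l : (l.+1 < N)%N -> l != p -> l != p.+1 -> E y l = E x l.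
  move=> lN lp lp1; rewrite /E (yE l (ltnW lN)) (yE _ lN).
  by rewrite eqSS (negbTE lp) (negbTE lp1).
(* No error of [y] exceeds [M], and optimality of [x] gives the other inequality; hence [y] is
   optimal too. *)
have yM : total_max_error f y = M.
  apply/le_anti; rewrite xO// andbT; apply: bigmax_le => [|l _].
    exact: ltW.
  rewrite -/(E y l); have [->|lp] := eqVneq (l : nat) p; first exact: ltW.
  have [->|lp1] := eqVneq (l : nat) p.+1; first exact: ltW.
  by rewrite EyE ?xM.
have yO : optimal_breakpoint_set f a b y by split=> // z zB; rewrite yM xO.
suff yk : (#|[set l : 'I_N.-1 | E y l == M]%SET| < k)%N.
  have := IH y yO; rewrite yM => /(_ yk p pN1) yp.
  by move: Eyp; rewrite /E yp ltxx.
suff prop : [set l : 'I_N.-1 | E y l == M]%SET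
    \proper [set l : 'I_N.-1 | E x l == M]%SET.
  by rewrite (leq_trans (proper_card prop)).
(* An interval of [y] with error [M] is neither of the two changed ones, so it has error [M] in [x]
   as well. The inclusion is strict because one of the two changed intervals had error [M] in
   [x]. *)
apply/properP; split.
  apply/fintype.subsetP => l; rewrite !inE -!/(E _ l) => Eyl.
  rewrite -EyE//.
    by apply: contraTneq Eyl => ->; rewrite lt_eqF.
  by apply: contraTneq Eyl => ->; rewrite lt_eqF.
have [q [qN Eyq Exq]] : exists q, [/\ (q < N.-1)%N, E y q < M & E x q == M].
  have [Exp|Exp] := boolP (E x p == M); first by exists p; rewrite (ltnW pN).
  exists p.+1; rewrite pN EyS; split=> //.
  by move: Ep; rewrite (negbTE Exp) eq_sym eqbF_neg negbK.
by exists (Ordinal qN); rewrite inE//= -/(E y q) lt_eqF.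
Qed.

Unset Implicit Arguments.
Set Strict Implicit.

Theorem theorem1 (R : realType) (a b : R) (f : R -> R) (N : nat)
    (x : N.-tuple R) :
  concave_on a b f ->
  max_errors_exist f a b ->
  (3 <= N)%N ->
  optimal_breakpoint_set f a b x ->
  forall i j : nat, (i.+1 < N)%N -> (j.+1 < N)%N ->
    max_error f x`_i x`_i.+1 = max_error f x`_j x`_j.+1.
Proof.
move=> fC fE _ xO i j iN jN.
(* The bound [k] is taken to be one more than the number of intervals of maximal error. *)
by rewrite !(optimal_errors_eq fC fE xO (ltnSn _)).
Qed.
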